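(* When the Hasse diagram of the rotation poset $\mathcal{R}$ of the preference profile $\succ$ is a path, the algorithm HassePath defined in the context returns a stable matching that achieves distortion $1+\varepsilon$ using at most $\frac{8\log_2(n)}{\varepsilon}$ queries per agent, for any $0<\varepsilon\le 1$. Here achieving distortion $1+\varepsilon$ means that for every valuation profile $\mathbf{v}$ consistent with such a $\succ$, the returned stable matching $\mu_A$ satisfies $\max_{\mu\in\mathcal{M}_s(\succ)}\mathrm{SW}(\mu\mid\mathbf{v})\le(1+\varepsilon)\,\mathrm{SW}(\mu_A\mid\mathbf{v})$.
   Context: Setting (stable matching): there are two disjoint sets of agents, men $M$ and women $W$, with $|M|=|W|=n$. Every agent $a$ has a valuation function $v_a$ assigning a non-negative real value to each agent of the opposite side; $\mathbf{v}$ denotes the profile of all valuation functions (no normalization is imposed). A preference profile $\succ$ consists of a strict ranking $\succ_a$ of the opposite side for each agent $a$. It is consistent with $\mathbf{v}$ if $b\succ_a b'$ implies $v_a(b)\ge v_a(b')$. A matching $\mu$ is a perfect one-to-one matching of $M$ and $W$; $\mu(a)$ is the partner of $a$. A pair $(m,w)$ is blocking for $\mu$ if $w\succ_m\mu(m)$ and $m\succ_w\mu(w)$; $\mu$ is stable if it has no blocking pair. $\mathcal{M}_s(\succ)$ is the set of stable matchings of $\succ$. Let $\mathrm{SW}_M(\mu\mid\mathbf{v})=\sum_{m\in M}v_m(\mu(m))$, $\mathrm{SW}_W(\mu\mid\mathbf{v})=\sum_{w\in W}v_w(\mu(w))$ and $\mathrm{SW}=\mathrm{SW}_M+\mathrm{SW}_W$.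 Query model: the algorithm knows $\succ$ and may ask adaptive value queries; a value query to agent $a$ about an agent $b$ of the opposite side returns $v_a(b)$. The number of queries is counted per agent. Learning $\mathrm{SW}_M(\mu\mid\mathbf{v})$ (resp. $\mathrm{SW}_W(\mu\mid\mathbf{v})$) for a matching $\mu$ costs one query to each man (resp. woman), for his (resp. her) partner in $\mu$. Rotations: for $k\ge2$, a rotation exposed in a stable matching $\mu$ is an ordered list $\rho=((m_0,w_0),\dots,(m_{k-1},w_{k-1}))$ of pairs matched in $\mu$ such that for every $i$ (indices mod $k$), $w_{i+1}$ is the highest-ranked woman $w$ on $m_i$'s list such that $w_i\succ_{m_i}w$ and $w$ prefers $m_i$ to her partner $\mu(w)$ (for $w=w_{i+1}$ this partner is $m_{i+1}$). Eliminating $\rho$ from $\mu$ means re-matching $m_i$ to $w_{i+1}$ for all $i$ (indices mod $k$), leaving other pairs unchanged; the result, denoted $\mu\setminus\rho$, is again stable. $R(\succ)$ is the set of all rotations exposed in some stable matching of $\succ$. Every stable matching $\mu$ is obtained from the man-optimal stable matching (in which every man has his best partner over all stable matchings) by eliminating a sequence of successively exposed rotations, and the set $R_\mu\subseteq R(\succ)$ of eliminated rotations is uniquely determined by $\mu$. For distinct $\rho,\rho'\in R(\succ)$ write $\rho\prec\rho'$ if $\rho\in R_\mu$ for every stable matching $\mu$ in which $\rho'$ is exposed. The rotation poset is $\mathcal{R}=(R(\succ),\preceq)$. Its Hasse diagram is the directed acyclic graph on $R(\succ)$ with an edge $(\rho,\rho')$ whenever $\rho\prec\rho'$ and there is no $\rho''$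 with $\rho\prec\rho''\prec\rho'$. That it is a path means that $\mathcal{R}$ is a chain $\rho_1\prec\dots\prec\rho_z$. Algorithm HassePath. Input: the Hasse diagram, the man-optimal stable matching $\mu_0$, and $\varepsilon$. Let $\mathcal{M}=(\mu_0,\mu_1,\dots,\mu_z)$ with $\mu_i=\mu_{i-1}\setminus\rho_i$ for $i=1,\dots,z$, and let $\mathcal{M}^r=(\mu_z,\dots,\mu_0)$ be its reverse. Initialize the targets $\mu_t^M=\mu_0$ and $\mu_t^W=\mu_z$, the lists $\mu_R^M=[\mu_0]$ and $\mu_R^W=[\mu_z]$, and let $k=\frac{2}{\log_2(1+\varepsilon)}-2$. For $\ell=1,2,\dots$ while $\ell\le k$: replace $\mu_t^M$ by PosetSearch$(\mathcal{M},\mu_t^M,\text{Man})$ and $\mu_t^W$ by PosetSearch$(\mathcal{M}^r,\mu_t^W,\text{Woman})$, and append the new $\mu_t^M$ to $\mu_R^M$ and the new $\mu_t^W$ to $\mu_R^W$. Finally, for each $\mu\in\mu_R^M$ query $\mathrm{SW}_W(\mu\mid\mathbf{v})$, for each $\mu\in\mu_R^W$ query $\mathrm{SW}_M(\mu\mid\mathbf{v})$, and return the matching in $\mu_R^M\cup\mu_R^W$ with the highest $\mathrm{SW}(\mu\mid\mathbf{v})$. Subroutine PosetSearch(sequence of matchings, current target, $B$). Index the matchings by their position in the given sequence, and let $t$ be the position of the current target. Let $q(i)$ be $\mathrm{SW}_M$ (if $B=$ Man) or $\mathrm{SW}_W$ (if $B=$ Woman) of the matching in position $i$, obtained by querying.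 Let $\theta=q(t)/(1+\varepsilon)$. By binary search over the positions after $t$ up to the last one (start with $L=t+1$, $R=$ last position, $\ell^\star$ undefined; while $L\le R$, let $m=\lfloor(L+R)/2\rfloor$; if $q(m)\ge\theta$ set $\ell^\star=m$ and $L=m+1$, else set $R=m-1$), find the largest position $\ell^\star$ with $q(\ell^\star)\ge\theta$. If $\ell^\star$ was found, return the matching in position $\ell^\star$; otherwise return the matching in position $t+1$ (None if there is no such position, in which case nothing further is appended for that side).
   Formalization: The loop runs k rounded up to an integer rounds (with the literal ''while ℓ ≤ k'' the distortion bound fails, e.g. at n = 3, ε = 0.7), and the query bound is claimed only for n ≥ 2, since at n = 1 it equals 0 although queries are made. *)

(* Defs.v *)
From HB Require Import structures.
From mathcomp Require Import all_boot all_order all_algebra.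
From mathcomp Require Import all_classical all_reals all_analysis.

Set Implicit Arguments.
Unset Strict Implicit.
Unset Printing Implicit Defensive.

Import Order.TTheory GRing.Theory Num.Theory.
Local Open Scope ring_scope.

Definition log2 (R : realType) (x : R) : R := ln x / ln 2.

(* [r x y] reads "x is strictly preferred to y". *)
Definition strict_ranking (T : eqType) (r : rel T) : Prop :=
  [/\ irreflexive r, transitive r & forall x y, x != y -> r x y || r y x].

Record preferences (M W : finType) := Preferences {
  prefM : M -> rel W;
  prefW : W -> rel M;
  prefM_strict : forall m, strict_ranking (prefM m);
  prefW_strict : forall w, strict_ranking (prefW w)
}.

(* The two partner maps of a matching: [mu.1 m] is the partner of the man [m],
   [mu.2 w] the partner of the woman [w].  The type also contains junk pairs of
   maps; [perfect_matching] selects the pairs that are inverse to each other. *)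
Definition pairing (M W : finType) : eqType :=
  ({ffun M -> W} * {ffun W -> M})%type.

Definition perfect_matching (M W : finType) (mu : pairing M W) : Prop :=
  cancel mu.1 mu.2 /\ cancel mu.2 mu.1.

Definition blocking (M W : finType) (P : preferences M W) (mu : pairing M W)
    (m : M) (w : W) : bool :=
  prefM P m w (mu.1 m) && prefW P w m (mu.2 w).

Definition stable (M W : finType) (P : preferences M W) (mu : pairing M W) :
    Prop :=
  perfect_matching mu /\ ~ exists m w, blocking P mu m w.

Definition man_optimal (M W : finType) (P : preferences M W)
    (mu0 : pairing M W) : Prop :=
  stable P mu0 /\
  forall mu, stable P mu ->
    forall m, mu0.1 m = mu.1 m \/ prefM P m (mu0.1 m) (mu.1 m).

Record valuations (R : realType) (M W : finType) := Valuations {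
  valM : M -> W -> R;
  valW : W -> M -> R;
  valM_ge0 : forall m w, 0 <= valM m w;
  valW_ge0 : forall w m, 0 <= valW w m
}.

Definition consistent (R : realType) (M W : finType) (P : preferences M W)
    (v : valuations R M W) : Prop :=
  (forall m w w', prefM P m w w' -> valM v m w' <= valM v m w) /\
  (forall w m m', prefW P w m m' -> valW v w m' <= valW v w m).

Definition SW_M (R : realType) (M W : finType) (v : valuations R M W)
    (mu : pairing M W) : R := \sum_(m : M) valM v m (mu.1 m).

Definition SW_W (R : realType) (M W : finType) (v : valuations R M W)
    (mu : pairing M W) : R := \sum_(w : W) valW v w (mu.2 w).

Definition SW (R : realType) (M W : finType) (v : valuations R M W)
    (mu : pairing M W) : R := SW_M v mu + SW_W v mu.

(* The list [(m_0,w_0), ..., (m_{k-1},w_{k-1})]; indices mod k are handled by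
   [next] and [prev] of the [path] library. *)
Definition rotation (M W : finType) : eqType := seq (M * W).

(* [w] may be the next woman of [m]: he likes her less than his partner, and
   she prefers him to hers. *)
Definition successor_candidate (M W : finType) (P : preferences M W)
    (mu : pairing M W) (m : M) (w : W) : bool :=
  prefM P m (mu.1 m) w && prefW P w m (mu.2 w).

Definition successor_woman (M W : finType) (P : preferences M W)
    (mu : pairing M W) (m : M) (w : W) : Prop :=
  successor_candidate P mu m w /\
  forall w', successor_candidate P mu m w' -> w' != w -> prefM P m w w'.

Definition exposed (M W : finType) (P : preferences M W) (mu : pairing M W)
    (rho : rotation M W) : Prop :=
  [/\ (2 <= size rho)%N, uniq rho &
      forall p, p \in rho ->
        mu.1 p.1 = p.2 /\ successor_woman P mu p.1 (next rho p).2].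

Definition eliminate (M W : finType) (mu : pairing M W) (rho : rotation M W) :
    pairing M W :=
  ([ffun m => if (m, mu.1 m) \in rho then (next rho (m, mu.1 m)).2
              else mu.1 m],
   [ffun w => if (mu.2 w, w) \in rho then (prev rho (mu.2 w, w)).1
              else mu.2 w]).

Definition is_rotation (M W : finType) (P : preferences M W)
    (rho : rotation M W) : Prop :=
  exists2 mu, stable P mu & exposed P mu rho.

(* A rotation is a cyclic list: the choice of its first pair is immaterial. *)
Definition same_rotation (M W : finType) (rho rho' : rotation M W) : Prop :=
  exists i, rho' = rot i rho.

(* [mu'] results from [mu] by eliminating successively exposed rotations [s]. *)
Fixpoint elimination (M W : finType) (P : preferences M W) (mu : pairing M W)
    (s : seq (rotation M W)) (mu' : pairing M W) : Prop :=
  if s is rho :: s' then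
    exposed P mu rho /\ elimination P (eliminate mu rho) s' mu'
  else mu = mu'.

(* [rho \in R_mu].  All elimination sequences from the man-optimal matching to
   a stable [mu] use the same rotations (and at least one sequence exists), so
   quantifying over all of them or over some of them is the same. *)
Definition eliminated (M W : finType) (P : preferences M W) (mu : pairing M W)
    (rho : rotation M W) : Prop :=
  forall mu0 s, man_optimal P mu0 -> elimination P mu0 s mu ->
    exists2 rho', rho' \in s & same_rotation rho rho'.

Definition rot_prec (M W : finType) (P : preferences M W)
    (rho rho' : rotation M W) : Prop :=
  ~ same_rotation rho rho' /\
  forall mu, stable P mu -> exposed P mu rho' -> eliminated P mu rho.

Definition hasse_edge (M W : finType) (P : preferences M W)
    (rho rho' : rotation M W) : Prop :=
  rot_prec P rho rho' /\
  ~ exists rho'', [/\ is_rotation P rho'', rot_prec P rho rho'' &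
                      rot_prec P rho'' rho'].

(* The Hasse diagram of the rotation poset is the directed path visiting
   [rhos] in this order.  The list holds one representative of each rotation;
   it is empty when there is a single stable matching. *)
Definition hasse_path (M W : finType) (P : preferences M W)
    (rhos : seq (rotation M W)) : Prop :=
  [/\ forall rho, rho \in rhos -> is_rotation P rho,
      forall rho, is_rotation P rho ->
        exists2 rho', rho' \in rhos & same_rotation rho rho',
      forall i j, (i < size rhos)%N -> (j < size rhos)%N ->
        same_rotation (nth [::] rhos i) (nth [::] rhos j) -> i = j &
      forall i j, (i < size rhos)%N -> (j < size rhos)%N ->
        hasse_edge P (nth [::] rhos i) (nth [::] rhos j) <-> j = i.+1].

(* [inl (m, w)] asks the man [m] for his value of [w], [inr (w, m)] asks the
   woman [w] for her value of [m]. *)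
Definition query (M W : finType) : Type := ((M * W) + (W * M))%type.

Definition answer (R : realType) (M W : finType) (v : valuations R M W)
    (q : query M W) : R :=
  match q with inl (m, w) => valM v m w | inr (w, m) => valW v w m end.

Definition asked_agent (M W : finType) (q : query M W) : M + W :=
  match q with inl (m, _) => inl m | inr (w, _) => inr w end.

(* Adaptive query algorithms as decision trees: the valuations are accessible
   only through [Ask]. *)
Inductive prog (R : realType) (M W : finType) (A : Type) : Type :=
| Ret of A
| Ask of query M W & (R -> prog R M W A).
Arguments Ret {R M W A} _.
Arguments Ask {R M W A} _ _.

Fixpoint bind (R : realType) (M W : finType) (A B : Type)
    (c : prog R M W A) (f : A -> prog R M W B) : prog R M W B :=
  match c with
  | Ret a => f a
  | Ask q k => Ask q (fun x => bind (k x) f)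
  end.

(* The result, together with the list of all queries asked. *)
Fixpoint run (R : realType) (M W : finType) (A : Type) (v : valuations R M W)
    (c : prog R M W A) : A * seq (query M W) :=
  match c with
  | Ret a => (a, [::])
  | Ask q k => let: (a, qs) := run v (k (answer v q)) in (a, q :: qs)
  end.

(* Repetitions of the same question are counted. *)
Definition num_queries (M W : finType) (a : M + W) (qs : seq (query M W)) :
    nat := count (fun q => asked_agent q == a) qs.

Definition side : Type := bool.
Definition Man : side := true.
Definition Woman : side := false.

(* The algorithm remembers the values of [SW_M] and [SW_W] learned so far, and
   does not ask for them again. *)
Definition memory (R : realType) (M W : finType) : Type :=
  seq ((bool * pairing M W) * R).

Fixpoint recall (R : realType) (M W : finType) (mem : memory R M W)
    (key : bool * pairing M W) : option R :=
  if mem is (key', x) :: mem' then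
    if key == key' then Some x else recall mem' key
  else None.

Definition comp (R : realType) (M W : finType) (A : Type) : Type :=
  memory R M W -> prog R M W (A * memory R M W).

Definition cret (R : realType) (M W : finType) (A : Type) (a : A) :
    comp R M W A := fun mem => Ret (a, mem).

Definition cbind (R : realType) (M W : finType) (A B : Type)
    (c : comp R M W A) (f : A -> comp R M W B) : comp R M W B :=
  fun mem => bind (c mem) (fun am => f am.1 am.2).

Local Notation "x <- c ; d" := (cbind c (fun x => d))
  (at level 100, c at next level, d at level 200, right associativity).

Fixpoint ask_sum (R : realType) (M W : finType) (qs : seq (query M W)) (acc : R)
    : prog R M W R :=
  if qs is q :: qs' then Ask q (fun x => ask_sum qs' (acc + x)) else Ret acc.

Definition partner_queries (M W : finType) (B : side)
    (mu : pairing M W) : seq (query M W) :=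
  if B then [seq inl (m, mu.1 m) | m <- enum M]
  else [seq inr (w, mu.2 w) | w <- enum W].

(* [SW_M mu] for [B = Man], [SW_W mu] for [B = Woman]. *)
Definition learn (R : realType) (M W : finType) (B : side)
    (mu : pairing M W) : comp R M W R :=
  fun mem =>
    if recall mem (B, mu) is Some x then Ret (x, mem)
    else bind (ask_sum (partner_queries B mu) 0)
              (fun x => Ret (x, ((B, mu), x) :: mem)).

(* [q i] learns the value at position [i]; [Rt] and [best] are the R and the
   l* of the search.  Each iteration shrinks the interval, so the fuel (the
   length of the sequence, below) is never exhausted. *)
Fixpoint binary_search (R : realType) (M W : finType) (q : nat -> comp R M W R)
    (theta : R) (fuel L Rt : nat) (best : option nat) :
    comp R M W (option nat) :=
  if fuel is fuel'.+1 then
    if (L <= Rt)%N then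
      let m := ((L + Rt) %/ 2)%N in
      x <- q m ;
      if theta <= x then binary_search q theta fuel' m.+1 Rt (Some m)
      else binary_search q theta fuel' L m.-1 best
    else cret best
  else cret best.

Definition poset_search (R : realType) (M W : finType) (eps : R)
    (ms : seq (pairing M W)) (target : pairing M W) (B : side) :
    comp R M W (option (pairing M W)) :=
  let q i := learn B (nth target ms i) in
  let t := index target ms in
  qt <- q t ;
  l <- binary_search q (qt / (1 + eps)) (size ms) t.+1 (size ms).-1 None ;
  cret (if l is Some i then Some (nth target ms i)
        else if (t.+1 < size ms)%N then Some (nth target ms t.+1) else None).

(* The current target of a side ([None] once the search has returned None) and
   the list of its targets so far. *)
Definition side_state (M W : finType) : Type :=
  (option (pairing M W) * seq (pairing M W))%type.

Definition side_step (R : realType) (M W : finType) (eps : R)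
    (ms : seq (pairing M W)) (B : side) (st : side_state M W) :
    comp R M W (side_state M W) :=
  if st.1 is Some target then
    new <- poset_search eps ms target B ;
    cret (if new is Some mu then (Some mu, rcons st.2 mu) else (None, st.2))
  else cret st.

Fixpoint rounds (R : realType) (M W : finType) (eps : R)
    (ms : seq (pairing M W)) (r : nat) (stM stW : side_state M W) :
    comp R M W (side_state M W * side_state M W) :=
  if r is r'.+1 then
    stM' <- side_step eps ms Man stM ;
    stW' <- side_step eps (rev ms) Woman stW ;
    rounds eps ms r' stM' stW'
  else cret (stM, stW).

(* The number of rounds is [2 / log2 (1 + eps) - 2], which is nonnegative for
   [0 < eps <= 1]; it is rounded up when it is not an integer.  Rounding down
   would break the 1 + eps guarantee: for eps = 0.7 no round would be made, and
   the better of the man-optimal and the woman-optimal matching only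
   guarantees a ratio of 2. *)
Definition num_rounds (R : realType) (eps : R) : nat :=
  `|Num.ceil (2 / log2 (1 + eps) - 2)|%N.

Fixpoint learn_all (R : realType) (M W : finType) (B : side)
    (s : seq (pairing M W)) : comp R M W unit :=
  if s is mu :: s' then _x <- learn B mu ; learn_all B s' else cret tt.

(* The first matching of highest social welfare among [best], of social welfare
   [x], and [s]. *)
Fixpoint select_best (R : realType) (M W : finType) (best : pairing M W) (x : R)
    (s : seq (pairing M W)) : comp R M W (pairing M W) :=
  if s is mu :: s' then
    yM <- learn Man mu ;
    yW <- learn Woman mu ;
    if x < yM + yW then select_best mu (yM + yW) s' else select_best best x s'
  else cret best.

Definition chain_matchings (M W : finType) (mu0 : pairing M W)
    (rhos : seq (rotation M W)) : seq (pairing M W) :=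
  mu0 :: scanl (@eliminate M W) mu0 rhos.

(* In [select_best] all welfare values are already in memory, except that with
   no round at all those of [mu0] on the men's side and of [muz] on the women's
   side still have to be asked (and are then counted). *)
Definition hasse_path_comp (R : realType) (M W : finType)
    (rhos : seq (rotation M W)) (mu0 : pairing M W) (eps : R) :
    comp R M W (pairing M W) :=
  let ms := chain_matchings mu0 rhos in
  let muz := last mu0 ms in
  sts <- rounds eps ms (num_rounds eps) (Some mu0, [:: mu0])
                (Some muz, [:: muz]) ;
  let listM := sts.1.2 in
  let listW := sts.2.2 in
  _x <- learn_all Woman listM ;
  _y <- learn_all Man listW ;
  xM <- learn Man mu0 ;
  xW <- learn Woman mu0 ;
  select_best mu0 (xM + xW) (listM ++ listW).

Definition HassePath (R : realType) (M W : finType)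
    (rhos : seq (rotation M W)) (mu0 : pairing M W) (eps : R) :
    prog R M W (pairing M W) :=
  bind (hasse_path_comp rhos mu0 eps [::]) (fun am => Ret am.1).

(* Main.v *)
(** When the rotations form a chain, each stable matching exposes at most one
rotation, namely the first one not yet eliminated; as any stable matching other
than [mu] that all men like less than [mu] can be approached by a rotation
exposed in [mu], the matchings mu_0, ..., mu_z are exactly the stable ones.
Along them the men's welfare decreases and the women's increases.

Let c = 1 + eps.  A target found by the men's search loses at most the factor c
of the men's welfare against all positions skipped, and only gains for the
women; so every position up to the last target is covered by a listed matching.
Two rounds divide the men's welfare by c, hence after K >= 2 / log2 c - 2 rounds
a position covered by neither side has men's welfare at most c / 2 times that
of mu_0 and women's welfare at most c / 2 times that of mu_z.  The sum is at
most c times the better of these two endpoints.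

Eliminating a rotation lowers the number of pairs (m, w) such that m likes his
partner more than w by at least 2, so 2z <= n (n - 1) and a binary search takes
N <= 4 log2 n - 3 queries.  As nothing is asked twice, an agent answers at most
K (N + 1) queries in the searches and 2 (K + 1) for the listed matchings, where
K < 2 / eps - 1. *)

Require Import Defs.
From HB Require Import structures.
From mathcomp Require Import all_boot all_order all_algebra.
From mathcomp Require Import all_classical all_reals all_analysis.
From mathcomp Require Import zify ring lra.
Import Order.TTheory GRing.Theory Num.Theory.
Local Open Scope ring_scope.

Set Implicit Arguments.
Unset Strict Implicit.
Unset Printing Implicit Defensive.

(** * Rotations and stable matchings *)

Section Rotations.
Variables (M W : finType) (P : preferences M W).
Implicit Types (mu : pairing M W) (rho : rotation M W).

Lemma prefM_irr m w : prefM P m w w = false.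
Proof. by case: (prefM_strict P m). Qed.

Lemma prefW_irr w m : prefW P w m m = false.
Proof. by case: (prefW_strict P w). Qed.

Lemma prefM_trans m : transitive (prefM P m).
Proof. by case: (prefM_strict P m). Qed.

Lemma prefW_trans w : transitive (prefW P w).
Proof. by case: (prefW_strict P w). Qed.

Lemma prefM_total m w w' : w != w' -> prefM P m w w' || prefM P m w' w.
Proof. by case: (prefM_strict P m) => _ _; exact. Qed.

Lemma prefW_total w m m' : m != m' -> prefW P w m m' || prefW P w m' m.
Proof. by case: (prefW_strict P w) => _ _; exact. Qed.

Definition men_prefer mu mu' : Prop :=
  forall m, mu.1 m = mu'.1 m \/ prefM P m (mu.1 m) (mu'.1 m).

Definition women_prefer mu mu' : Prop :=
  forall w, mu.2 w = mu'.2 w \/ prefW P w (mu.2 w) (mu'.2 w).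

Lemma men_prefer_refl mu : men_prefer mu mu.
Proof. by move=> m; left. Qed.

Lemma men_prefer_trans mu2 mu1 mu3 :
  men_prefer mu1 mu2 -> men_prefer mu2 mu3 -> men_prefer mu1 mu3.
Proof.
move=> h12 h23 m; case: (h12 m) => [->|p12]; first exact: h23.
by case: (h23 m) => [<-|p23]; right => //; apply: prefM_trans p12 p23.
Qed.

Lemma men_prefer_anti mu mu' : perfect_matching mu -> perfect_matching mu' ->
  men_prefer mu mu' -> men_prefer mu' mu -> mu = mu'.
Proof.
case: mu mu' => [f g] [f' g'] [/= fK gK] [/= f'K g'K] h h'.
have eqf m : f m = f' m.
  case: (h m) => //= p; case: (h' m) => //= p'.
  by have := prefM_trans p p'; rewrite prefM_irr.
have -> : f = f' by apply/ffunP.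
congr pair; apply/ffunP => w.
by rewrite -[in RHS](gK w) eqf f'K.
Qed.

Lemma exposed_rot i mu rho : exposed P mu rho -> exposed P mu (rot i rho).
Proof.
case=> sz un h; split; rewrite ?size_rot ?rot_uniq // => p.
by rewrite mem_rot next_rot //; apply: h.
Qed.

Lemma eliminate_rot i mu rho : uniq rho ->
  eliminate mu (rot i rho) = eliminate mu rho.
Proof.
move=> un; congr pair; apply/ffunP => x; rewrite !ffunE mem_rot.
  by rewrite next_rot.
by rewrite prev_rot.
Qed.

Lemma same_rotation_sym rho rho' :
  same_rotation rho rho' -> same_rotation rho' rho.
Proof.
case=> i ->; exists (size rho - i)%N; rewrite -[in LHS](rotK i rho).
by rewrite /rotr size_rot.
Qed.

(** * Eliminating one exposed rotation *)

Section Elimination.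
Variables (mu : pairing M W) (rho : rotation M W).
Hypotheses (mu_stable : stable P mu) (rho_exposed : exposed P mu rho).

Lemma men_prefer_eliminate : men_prefer mu (eliminate mu rho).
Proof.
move=> m; rewrite /= ffunE; case: ifP => [inr|_]; last by left.
have [_ _ /(_ _ inr) [_ [/andP[/= h _] _]]] := rho_exposed.
by right.
Qed.

Lemma eliminate_strict p : p \in rho ->
  prefM P p.1 p.2 ((eliminate mu rho).1 p.1).
Proof.
move=> inr; have [_ _ /(_ _ inr) [e [/andP[/= h _] _]]] := rho_exposed.
by rewrite /= ffunE e -surjective_pairing inr -e.
Qed.

Lemma women_prefer_eliminate : women_prefer (eliminate mu rho) mu.
Proof.
move=> w; rewrite /= ffunE; case: ifP => [inr|_]; last by left.
have [_ un h] := rho_exposed; right.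
have inp : prev rho (mu.2 w, w) \in rho by rewrite mem_prev.
by have [_ [/andP[_]]] := h _ inp; rewrite next_prev.
Qed.

Lemma eliminate_perfect : perfect_matching (eliminate mu rho).
Proof.
have [[fK gK] _] := mu_stable; have [_ un h] := rho_exposed.
split=> x; rewrite /= !ffunE.
  have [inr|nin] := boolP ((x, mu.1 x) \in rho); last by rewrite fK (negPf nin).
  have inn : next rho (x, mu.1 x) \in rho by rewrite mem_next.
  have [e _] := h _ inn.
  have e2 : mu.2 (next rho (x, mu.1 x)).2 = (next rho (x, mu.1 x)).1.
    by rewrite -e fK.
  by rewrite e2 -surjective_pairing inn prev_next.
have [inr|nin] := boolP ((mu.2 x, x) \in rho); last by rewrite gK (negPf nin).
have inn : prev rho (mu.2 x, x) \in rho by rewrite mem_prev.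
have [e _] := h _ inn.
by rewrite e -surjective_pairing inn next_prev.
Qed.

(** In a pair blocking the new matching the woman preferred [m] to her partner in [mu] as well, so
    stability of [mu] makes her a successor candidate of [m]. But a moved man got his best
    candidate, and an unmoved man likes his partner more. *)
Lemma eliminate_stable : stable P (eliminate mu rho).
Proof.
split; first exact: eliminate_perfect.
have [[fK gK] nb] := mu_stable; have [_ un h] := rho_exposed.
case=> m [w /andP[bm bw]].
have bw' : prefW P w m (mu.2 w).
  case: (women_prefer_eliminate w) => [<- //|]; exact: prefW_trans.
have mw : w != mu.1 m.
  by apply: contraTneq bw' => ->; rewrite fK prefW_irr.
have cand : prefM P m (mu.1 m) w.
  case/orP: (prefM_total m mw) => // p.
  by case: nb; exists m, w; rewrite /blocking p.
move: bm; rewrite /= ffunE; case: ifPn => [inr bm|_ bm]; last first.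
  by have := prefM_trans cand bm; rewrite prefM_irr.
have [_ [_ /= /(_ w)]] := h _ inr.
rewrite /successor_candidate cand bw' => /(_ isT) best.
have nw : w != (next rho (m, mu.1 m)).2.
  by apply: contraTneq bm => <-; rewrite prefM_irr.
by have := prefM_trans bm (best nw); rewrite prefM_irr.
Qed.

End Elimination.

Lemma best_candidate (m : M) (A : pred W) (w0 : W) : A w0 ->
  exists2 w, A w & forall w', A w' -> w' != w -> prefM P m w w'.
Proof.
move=> Aw0.
(* Counting the women ranked below [w] turns the ranking into a number to maximise. *)
pose worse w := #|[pred w' | prefM P m w w']|.
have [w Aw wmax] := @arg_maxnP _ w0 A worse Aw0.
exists w => // w' Aw' nw; case/orP: (prefM_total m nw) => // p.
have /= := wmax _ Aw'; rewrite leqNgt => /negP[]; apply: proper_card.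
apply/properP; split.
  by apply/fintype.subsetP => u; rewrite !inE; apply: prefM_trans p.
by exists w; rewrite !inE ?p ?prefM_irr.
Qed.

(* The exposed rotation is a cycle of the map sending a man [m] who is not
   matched alike in [mu] and [mu'] to the [mu]-partner of his successor woman:
   stability of [mu'] keeps this map inside the set of such men. *)
Lemma exists_exposed mu mu' : stable P mu -> stable P mu' ->
  men_prefer mu mu' -> mu != mu' ->
  exists2 rho, exposed P mu rho & men_prefer (eliminate mu rho) mu'.
Proof.
move=> st st' dom neq.
have [[fK gK] nb] := st; have [[f'K g'K] nb'] := st'.
pose D m := mu.1 m != mu'.1 m.
have DP m : D m -> prefM P m (mu.1 m) (mu'.1 m).
  by rewrite /D => /eqP d; case: (dom m).
(* Otherwise [w] prefers her partner in [mu] to [m]; that man likes [w] more than his partner in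
   [mu'], so the two block [mu']. *)
have cand m : D m -> successor_candidate P mu m (mu'.1 m).
  move=> Dm; rewrite /successor_candidate DP //=; set w := mu'.1 m.
  have nm : m != mu.2 w.
    by apply: contraNneq Dm => e; rewrite -/w e gK.
  case/orP: (prefW_total w nm) => // p.
  have D'' : D (mu.2 w).
    rewrite /D gK; apply: contraNneq nm => e.
    by rewrite -[X in _ == X]f'K -e /w f'K.
  case: nb'; exists (mu.2 w), w; rewrite /blocking /w f'K p andbT.
  by have := DP _ D''; rewrite gK.
have succ m : D m -> exists w, successor_woman P mu m w.
  move=> Dm; have [w cw h] := best_candidate m (cand m Dm).
  by exists w; split.
have [s sP] : exists s : M -> W, forall m, D m -> successor_woman P mu m (s m).
  have hs m : exists w, D m -> successor_woman P mu m w.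
    case: (boolP (D m)) => Dm; last by exists (mu.1 m).
    by have [w hw] := succ m Dm; exists w.
  by exists (fun m => projT1 (cid (hs m))) => m; case: (cid (hs m)).
have sdom m : D m -> s m = mu'.1 m \/ prefM P m (s m) (mu'.1 m).
  move=> Dm; have [_ best] := sP m Dm.
  have [->|ne] := eqVneq (mu'.1 m) (s m); first by left.
  by right; apply: best => //; apply: cand.
pose f m := mu.2 (s m).
(* If [f m] kept [s m] in [mu'], she would prefer [m] to her partner there; since [m] likes her at
   least as much as his partner in [mu'], either they block [mu'] or she prefers [m] to himself. *)
have Df m : D m -> D (f m).
  move=> Dm; rewrite /D /f gK; apply/eqP => e.
  have [/andP[c1 c2] _] := sP m Dm.
  have e2 : mu'.2 (s m) = mu.2 (s m) by rewrite [in LHS]e f'K.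
  case: (sdom m Dm) => [e'|p].
    by move: c2; rewrite -e2 e' f'K prefW_irr.
  by case: nb'; exists m, (s m); rewrite /blocking p e2.
have [m0 Dm0] : exists m, D m.
  apply/existsP; apply: contraNT neq; rewrite negb_exists => /forallP h.
  apply/eqP; apply: men_prefer_anti dom _; [by case: st|by case: st'|].
  by move=> m; left; apply/esym/eqP; have := h m; rewrite negbK.
have Diter k : D (iter k f m0) by elim: k => //= k; apply: Df.
(* The orbit of [m0] may begin with a tail; [x] is the point to which it returns, so the orbit of
   [x] is a cycle. *)
have /trajectP[i lti ei] := looping_order f m0.
set x := iter i f m0.
have cyc : fcycle f (orbit f x).
  apply/(orbitPcycle 0%N 3%N); exists (order f m0 - i.+1)%N.
  by rewrite subnSK // /x -iterD subnK 1?ltnW // ei.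
have Dorb y : y \in orbit f x -> D y.
  by case/trajectP => k _ ->; rewrite /x -iterD.
have un : uniq (orbit f x) by apply: orbit_uniq.
pose g m : M * W := (m, mu.1 m).
have g_inj : injective g by move=> a b [].
have nx y : y \in orbit f x -> next (map g (orbit f x)) (g y) = g (f y).
  move=> iny; rewrite next_map //; congr g.
  by have /eqP := next_cycle cyc iny.
(* At a fixed point of [f] a man's successor would be his own partner. *)
have sz : (2 <= size (map g (orbit f x)))%N.
  have Dx : D x by apply: Diter.
  have nfx : f x != x.
    have [/andP[c1 _] _] := sP x Dx.
    by apply: contraTneq c1 => e; rewrite -[X in mu.1 X]e /f gK prefM_irr.
  rewrite size_map ltnNge; apply: contra nfx.
  have : f x \in orbit f x by rewrite -fconnect_orbit fconnect1.
  have : x \in orbit f x by rewrite -fconnect_orbit.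
  case: (orbit f x) => [//|a [|//]].
  by rewrite !inE => /eqP -> /eqP ->.
have ex : exposed P mu (map g (orbit f x)).
  split=> //; first by rewrite map_inj_uniq.
  move=> p /mapP[y iny ->]; split=> //=.
  by rewrite nx //= /f gK; apply/sP/Dorb.
exists (map g (orbit f x)) => // m; rewrite /= ffunE.
case: ifP => [|_]; last exact: dom.
rewrite -/(g m) mem_map // => inm; rewrite nx //= /f gK.
by apply/sdom/Dorb.
Qed.

(** A potential that falls with each elimination: a termination measure, and a bound on the length
    of elimination sequences. *)
Definition worse_women mu : nat :=
  \sum_m #|[pred w | prefM P m (mu.1 m) w]|.

Lemma worse_women_max mu : (worse_women mu <= #|M| * #|W|.-1)%N.
Proof.
rewrite -sum_nat_const; apply: leq_sum => m _.
have W0 : (0 < #|W|)%N by apply/card_gt0P; exists (mu.1 m).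
rewrite -ltnS prednK //; apply: proper_card; apply/properP; split.
  exact/fintype.subsetP.
by exists (mu.1 m); rewrite !inE ?prefM_irr.
Qed.

(** Each man of the rotation stops counting his new partner, and there are at least two such men
    because distinct pairs of [rho] have distinct men. *)
Lemma worse_women_eliminate mu rho : exposed P mu rho ->
  (worse_women (eliminate mu rho) + 2 <= worse_women mu)%N.
Proof.
move=> ex; have [sz un h] := ex.
have un1 : uniq (map fst rho).
  rewrite map_inj_in_uniq // => p q /h[ep _] /h[eq _] e.
  by rewrite (surjective_pairing p) (surjective_pairing q) -ep -eq e.
pose moved m : nat := m \in map fst rho.
have mv : (2 <= \sum_m moved m)%N.
  rewrite /moved -big_mkcond /= sum1_card.
  by rewrite (card_uniqP un1) size_map.
apply: leq_trans (leq_add (leqnn _) mv) _.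
rewrite /worse_women -big_split /=; apply: leq_sum => m _.
rewrite /moved; case: (boolP (m \in map fst rho)) => [/mapP[p inp ->]|nin].
  rewrite addn1; apply: proper_card; have [ep _] := h _ inp.
  have st := eliminate_strict ex inp; rewrite -ep in st.
  apply/properP; split.
    by apply/fintype.subsetP => u; rewrite !inE; apply: prefM_trans st.
  by exists ((eliminate mu rho).1 p.1); rewrite !inE ?st ?prefM_irr.
rewrite addn0 ffunE ifN //.
by apply: contra nin => inr; apply/mapP; eexists; [exact: inr|].
Qed.

(** * Sequences of eliminations *)

Lemma elimination_cat mu s1 s2 mu' :
  elimination P mu (s1 ++ s2) mu' <->
  exists2 nu, elimination P mu s1 nu & elimination P nu s2 mu'.
Proof.
elim: s1 mu => [|r s1 IH] mu /=; first by split=> [|[nu ->]//]; exists mu.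
split=> [[e /IH[nu h1 h2]]|[nu [e h1] h2]]; first by exists nu.
by split=> //; apply/IH; exists nu.
Qed.

Lemma elimination_rcons mu s rho mu' :
  elimination P mu (rcons s rho) mu' <->
  exists nu, [/\ elimination P mu s nu, exposed P nu rho &
                 mu' = eliminate nu rho].
Proof.
rewrite -cats1; split=> [/elimination_cat[nu h /= [e <-]]|[nu [h e ->]]].
  by exists nu.
by apply/elimination_cat; exists nu.
Qed.

Lemma elimination_fun mu s mu1 mu2 :
  elimination P mu s mu1 -> elimination P mu s mu2 -> mu1 = mu2.
Proof.
elim: s mu => [|r s IH] mu /=; first by move=> <- <-.
by case=> _ h1 [_ h2]; apply: IH h1 h2.
Qed.

Lemma elimination_stable mu s mu' :
  stable P mu -> elimination P mu s mu' -> stable P mu'.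
Proof.
elim: s mu => [|r s IH] mu st /=; first by move=> <-.
by case=> ex; apply: IH; apply: eliminate_stable.
Qed.

Lemma elimination_men_prefer mu s mu' :
  elimination P mu s mu' -> men_prefer mu mu'.
Proof.
elim: s mu => [|r s IH] mu /=; first by move=> <-; exact: men_prefer_refl.
by case=> ex /IH; apply: men_prefer_trans; apply: men_prefer_eliminate.
Qed.

Lemma elimination_length mu s mu' :
  elimination P mu s mu' -> (2 * size s <= worse_women mu)%N.
Proof.
elim: s mu => [|r s IH] mu //= [ex /IH].
have h1 := worse_women_eliminate ex => h2; rewrite mulnS addnC.
exact: leq_trans (leq_add h2 (leqnn 2)) h1.
Qed.

Lemma elimination_exists mu mu' : stable P mu -> stable P mu' ->
  men_prefer mu mu' -> exists s, elimination P mu s mu'.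
Proof.
have [k] := ubnP (worse_women mu); elim: k mu => // k IH mu lek st st' dom.
have [->|neq] := eqVneq mu mu'; first by exists [::].
have [rho ex dom'] := exists_exposed st st' dom neq.
have [||s h] := IH (eliminate mu rho) _ _ st' dom'.
- by have := worse_women_eliminate ex; lia.
- exact: eliminate_stable.
by exists (rho :: s).
Qed.

(* The men of an eliminated rotation are strictly worse off ever after. *)
Lemma not_exposed_again mu s1 rho s2 mu' rho' : stable P mu ->
  elimination P mu (s1 ++ rho :: s2) mu' -> same_rotation rho rho' ->
  ~ exposed P mu' rho'.
Proof.
move=> st /elimination_cat[nu h1 /= [ex h2]] /same_rotation_sym[i er].
subst rho.
move=> [sz _ h].
have [p inp] : exists p, p \in rho' 
  by case: (rho') sz => // p l _; exists p; rewrite inE eqxx.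
have [e _] := h _ inp.
have inp' : p \in rot i rho' by rewrite mem_rot.
have := eliminate_strict ex inp'; rewrite -e.
case: (elimination_men_prefer h2 p.1) => [->|]; first by rewrite prefM_irr.
by move=> q1 q2; have := prefM_trans q2 q1; rewrite prefM_irr.
Qed.

End Rotations.

(** * Stable matchings when the Hasse diagram is a path *)

Section HassePath.
Variables (M W : finType) (P : preferences M W) (mu0 : pairing M W).
Variable rhos : seq (rotation M W).
Hypotheses (mu0_opt : man_optimal P mu0) (rhos_path : hasse_path P rhos).

Let mu0_stable : stable P mu0. Proof. by case: mu0_opt. Qed.

Lemma reachable mu : stable P mu -> exists s, elimination P mu0 s mu.
Proof.
by move=> st; apply: elimination_exists => //; case: mu0_opt => _; exact.
Qed.

(** Edges relate neighbours only, hence induction on [j]: the predecessor of entry [j] occurs in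
    [s], so it was exposed earlier, and the induction hypothesis applies to the part of [s] before
    it. *)
Lemma nth_precedes i j mu s : (i < j)%N -> (j < size rhos)%N ->
  elimination P mu0 s mu -> exposed P mu (nth [::] rhos j) ->
  exists2 rho, rho \in s & same_rotation (nth [::] rhos i) rho.
Proof.
case: rhos_path => _ _ _ edge.
elim: j mu s => // j IH mu s; rewrite ltnS => leij ltj el ex.
have st := elimination_stable mu0_stable el.
have [[_ prec] _] : hasse_edge P (nth [::] rhos j) (nth [::] rhos j.+1).
  by apply/edge => //; apply: ltnW.
have [rho ins same] := prec _ st ex _ _ mu0_opt el.
move: leij; rewrite leq_eqVlt => /predU1P[->|ltij]; first by exists rho.
case/splitPr: ins el => s1 s2 /elimination_cat[nu el1 /= [ex' _]].
have /IH : exposed P nu (nth [::] rhos j).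
  by have [k ->] := same_rotation_sym same; apply: exposed_rot.
move=> /(_ _ ltij (ltnW ltj) el1)[rho' ins' same'].
by exists rho' => //; rewrite mem_cat ins'.
Qed.

(** The exposed rotation is some entry [j]. If [j < i], it has been eliminated and cannot be exposed
    again; if [i < j], entry [i] would have to be among the first [i] entries. *)
Lemma exposed_next i mu rho : (i <= size rhos)%N ->
  elimination P mu0 (take i rhos) mu -> exposed P mu rho ->
  (i < size rhos)%N /\ same_rotation rho (nth [::] rhos i).
Proof.
move=> lei el ex; case: (rhos_path) => _ all_rot dist _.
have st := elimination_stable mu0_stable el.
have [rho' inr' same] : exists2 rho', rho' \in rhos & same_rotation rho rho'.
  by apply: all_rot; exists mu.
have /(nthP [::])[j ltj ej] := inr'; subst rho'.
have ex' : exposed P mu (nth [::] rhos j).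
  by have [k ->] := same; apply: exposed_rot.
have [ltji|] := ltnP j i.
  have tk : take i rhos =
      take j rhos ++ nth [::] rhos j :: drop j.+1 (take i rhos).
    rewrite -[LHS](cat_take_drop j) take_takel ?(ltnW ltji) //.
    congr cat; rewrite (drop_nth [::]) ?size_take ?nth_take //.
    by case: ifP => //; lia.
  rewrite tk in el.
  by case: (not_exposed_again mu0_stable el _ ex'); exists 0%N; rewrite rot0.
rewrite leq_eqVlt => /predU1P[->//|ltij].
have [rho' inr same'] := nth_precedes ltij ltj el ex'.
have /(nthP [::])[k] := inr; rewrite size_takel // => ltk.
rewrite nth_take // => ek.
have := dist i k (ltn_trans ltij ltj) (leq_trans ltk lei).
by rewrite ek => /(_ same'); lia.
Qed.

(** By [exposed_next] every step is forced up to the choice of the first pair, which does not affect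
    the elimination. *)
Lemma elimination_take s mu : elimination P mu0 s mu ->
  (size s <= size rhos)%N /\ elimination P mu0 (take (size s) rhos) mu.
Proof.
elim/last_ind: s mu => [|s rho IH] mu; first by rewrite take0.
case/elimination_rcons => nu [/IH[les el] ex ->].
have [lts same] := exposed_next les el ex.
rewrite size_rcons; split=> //; rewrite (take_nth [::]) //.
apply/elimination_rcons; exists nu.
have [k e] := same; split=> //; first by rewrite e; apply: exposed_rot.
by rewrite e eliminate_rot //; case: ex.
Qed.

(** The last entry is exposed in some stable matching. A sequence reaching that matching follows the
    path and, by [exposed_next] and distinctness, has eliminated exactly the entries before the
    last. *)
Lemma elimination_path : exists muz, elimination P mu0 rhos muz.
Proof.
case: (posnP (size rhos)) => [/size0nil ->|szg0]; first by exists mu0.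
case: (rhos_path) => rots _ dist _.
have ltz : ((size rhos).-1 < size rhos)%N by rewrite prednK.
have [mu st ex] := rots _ (mem_nth [::] ltz).
have [s /elimination_take[les el]] := reachable st.
have [lts same] := exposed_next les el ex.
have := dist _ _ ltz lts same => e.
exists (eliminate mu (nth [::] rhos (size rhos).-1)).
have -> : rhos =
    rcons (take (size rhos).-1 rhos) (nth [::] rhos (size rhos).-1).
  by rewrite -take_nth // prednK // take_size.
apply/elimination_rcons; exists mu; rewrite -take_nth // prednK // take_size.
by rewrite [in take _ _]e.
Qed.

Lemma size_path : (2 * size rhos <= #|M| * #|W|.-1)%N.
Proof.
have [muz el] := elimination_path.
exact: leq_trans (elimination_length el) (worse_women_max _ _).
Qed.

Lemma chain_nth (s : seq (rotation M W)) mu mu' i : elimination P mu s mu' ->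
  (i <= size s)%N ->
  elimination P mu (take i s) (nth mu (chain_matchings mu s) i).
Proof.
elim: s mu i => [|r s IH] mu [|i] //= [ex el] lei; split=> //.
have := IH _ _ el lei.
by rewrite /chain_matchings (set_nth_default (eliminate mu r)) //= size_scanl.
Qed.

Lemma chain_mem mu : (mu \in chain_matchings mu0 rhos) <-> stable P mu.
Proof.
have [muz elz] := elimination_path.
split=> [/(nthP mu0)[i]|st].
  rewrite /= size_scanl ltnS => lei <-.
  exact: elimination_stable (chain_nth elz lei).
have [s /elimination_take[les el]] := reachable st.
rewrite (elimination_fun el (chain_nth elz les)) mem_nth //=.
by rewrite size_scanl.
Qed.

End HassePath.

(** * Monotonicity of welfare along the chain *)

Section ChainOrder.
Variables (R : realType) (M W : finType) (P : preferences M W).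
Variables (v : valuations R M W) (v_consistent : consistent P v).

(** The strict third component makes the relation irreflexive, so a sorted chain has no
    repetition. *)
Definition chain_rel : rel (pairing M W) := fun mu mu' =>
  [&& SW_M v mu' <= SW_M v mu, SW_W v mu <= SW_W v mu' &
      (worse_women P mu' < worse_women P mu)%N].

Lemma chain_rel_trans : transitive chain_rel.
Proof.
move=> y x z /and3P[a1 a2 a3] /and3P[b1 b2 b3]; apply/and3P; split.
- exact: le_trans b1 a1.
- exact: le_trans a2 b2.
- exact: ltn_trans b3 a3.
Qed.

Lemma chain_rel_irr : irreflexive chain_rel.
Proof. by move=> x; rewrite /chain_rel ltnn !andbF. Qed.

Lemma chain_rel_eliminate mu rho : exposed P mu rho ->
  chain_rel mu (eliminate mu rho).
Proof.
case: v_consistent => cM cW ex; apply/and3P; split.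
- apply: ler_sum => m _; case: (men_prefer_eliminate ex m) => [->//|].
  exact: cM.
- apply: ler_sum => w _; case: (women_prefer_eliminate ex w) => [->//|].
  exact: cW.
- by have := worse_women_eliminate ex; lia.
Qed.

Lemma chain_sorted mu s mu' : elimination P mu s mu' ->
  sorted chain_rel (chain_matchings mu s).
Proof.
elim: s mu => [|r s IH] mu //= [ex /IH h].
by rewrite chain_rel_eliminate.
Qed.

End ChainOrder.
(** * Adaptive queries and the two searches *)

Section Queries.
Variables (R : realType) (M W : finType) (v : valuations R M W).
Implicit Types (mu : pairing M W) (mem : memory R M W) (B : side).

Definition side_welfare B mu : R := if B then SW_M v mu else SW_W v mu.

Lemma side_welfare_ge0 B mu : 0 <= side_welfare B mu.
Proof.
by case: B; apply: sumr_ge0 => x _; [exact: valM_ge0|exact: valW_ge0].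
Qed.

Lemma SW_side B mu : SW v mu = side_welfare B mu + side_welfare (~~ B) mu.
Proof. by case: B; rewrite // addrC. Qed.

Lemma SW_ge0 mu : 0 <= SW v mu.
Proof. by rewrite (SW_side Man) addr_ge0 ?side_welfare_ge0. Qed.

Definition side_of (a : M + W) : side := if a is inl _ then Man else Woman.

Definition keys mem : seq (side * pairing M W) := map fst mem.

Definition count_side B (ks : seq (side * pairing M W)) : nat :=
  count (fun k => k.1 == B) ks.

Definition correct_memory mem : Prop :=
  uniq (keys mem) /\
  forall e, e \in mem -> e.2 = side_welfare e.1.1 e.1.2.

(* Since every sum is asked at most once, the number of queries to an agent is
   the number of new keys of the agent's side; [Q] relates the result to a list
   covering the new keys. *)
Definition triple (A : Type) (c : Defs.comp R M W A)
    (Q : A -> seq (side * pairing M W) -> Prop) : Prop :=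
  forall mem, correct_memory mem -> exists a mem' ks qs,
    [/\ run v (c mem) = ((a, mem'), qs), correct_memory mem', Q a ks,
        {subset keys mem' <= keys mem ++ ks} &
        forall ag, (num_queries ag qs + count_side (side_of ag) (keys mem))%N
                   = count_side (side_of ag) (keys mem')].

Lemma run_bind (A A' : Type) (c : prog R M W A) (f : A -> prog R M W A') :
  run v (bind c f) =
  let: (a, qs) := run v c in let: (b, qs') := run v (f a) in (b, qs ++ qs').
Proof.
elim: c => [a|q k IH] /=; first by case: (run v (f a)).
rewrite IH; case: (run v (k _)) => a qs.
by case: (run v (f a)).
Qed.

Lemma triple_ret (A : Type) (a : A) Q : Q a [::] -> triple (cret a) Q.
Proof.
move=> Qa mem cm; exists a, mem, [::], [::]; split=> //.
by rewrite cats0 => k.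
Qed.

Lemma triple_bind (A A' : Type) (c : Defs.comp R M W A)
    (f : A -> Defs.comp R M W A') Q Q' :
  triple c Q ->
  (forall a ks, Q a ks -> triple (f a) (fun b ks' => Q' b (ks ++ ks'))) ->
  triple (cbind c f) Q'.
Proof.
move=> tc tf mem cm.
have [a [mem1 [ks1 [qs1 [e1 cm1 Q1 s1 n1]]]]] := tc mem cm.
have [b [mem2 [ks2 [qs2 [e2 cm2 Q2 s2 n2]]]]] := tf _ _ Q1 _ cm1.
exists b, mem2, (ks1 ++ ks2), (qs1 ++ qs2); split=> //.
- by rewrite /cbind run_bind e1 /= e2.
- move=> k /s2; rewrite catA mem_cat => /orP[/s1|];
    rewrite [in X in _ -> X]mem_cat.
    by move=> ->.
  by move=> ->; rewrite orbT.
- by move=> ag; rewrite -n2 -n1 /num_queries count_cat -addnA addnCA.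
Qed.

Lemma triple_weaken (A : Type) (c : Defs.comp R M W A) (Q Q' : A -> _ -> Prop) :
  (forall a ks, Q a ks -> Q' a ks) -> triple c Q -> triple c Q'.
Proof.
move=> QQ' tc mem /tc[a [mem' [ks [qs [e cm Qa s n]]]]].
by exists a, mem', ks, qs; split=> //; apply: QQ'.
Qed.

Lemma run_ask_sum (qs : seq (query M W)) (acc : R) :
  run v (ask_sum qs acc) = (acc + \sum_(q <- qs) answer v q, qs).
Proof.
elim: qs acc => [|q qs IH] acc /=; first by rewrite big_nil addr0.
by rewrite IH big_cons addrA.
Qed.

Lemma sum_partner_queries B mu :
  \sum_(q <- partner_queries B mu) answer v q = side_welfare B mu.
Proof. by case: B; rewrite /= big_map big_enum. Qed.

Lemma num_partner_queries B mu ag :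
  num_queries ag (partner_queries B mu) = (B == side_of ag).
Proof.
case: B ag => -[a|a]; rewrite /num_queries /= count_map.
- by rewrite (@eq_count _ _ (pred1 a)) // count_uniq_mem ?enum_uniq ?mem_enum.
- by rewrite (@eq_count _ _ pred0) ?count_pred0.
- by rewrite (@eq_count _ _ pred0) ?count_pred0.
- by rewrite (@eq_count _ _ (pred1 a)) // count_uniq_mem ?enum_uniq ?mem_enum.
Qed.

Lemma recall_some mem k x : recall mem k = Some x -> (k, x) \in mem.
Proof.
elim: mem => //= -[k' x'] mem IH.
case: eqVneq => [-> [->]|_ /IH h]; first by rewrite mem_head.
by rewrite inE h orbT.
Qed.

Lemma recall_none mem k : recall mem k = None -> k \notin keys mem.
Proof.
elim: mem => //= -[k' x'] mem IH.
by case: eqVneq => // ne /IH h; rewrite inE negb_or ne.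
Qed.

(** The key is listed even when the value is recalled: the list only has to cover the new keys. *)
Lemma triple_learn B mu :
  triple (learn B mu)
    (fun x ks => x = side_welfare B mu /\ ks = [:: (B, mu)]).
Proof.
move=> mem [un val]; rewrite /learn.
case e: (recall mem (B, mu)) => [x|].
  exists x, mem, [:: (B, mu)], [::]; split=> //.
    by split=> //; exact: val (recall_some e).
  by move=> k h; rewrite mem_cat h.
exists (side_welfare B mu), (((B, mu), side_welfare B mu) :: mem), [:: (B, mu)].
exists (partner_queries B mu); split=> //.
- by rewrite run_bind run_ask_sum /= sum_partner_queries add0r cats0.
- split; first by rewrite /= recall_none.
  by move=> p; rewrite inE => /predU1P[->|/val].
- by move=> k; rewrite mem_cat /= !inE orbC.
- by move=> ag; rewrite num_partner_queries.
Qed.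

(** * Binary search in a nonincreasing sequence *)

Section BinarySearch.
Variables (q : nat -> Defs.comp R M W R) (f : nat -> R).
Variables (kf : nat -> side * pairing M W) (sz : nat) (theta : R).
Hypothesis q_triple :
  forall i, triple (q i) (fun x ks => x = f i /\ ks = [:: kf i]).
Hypothesis f_mono : forall i j, (i <= j)%N -> (j < sz)%N -> f j <= f i.

Definition search_result L Rt best (r : option nat) : Prop :=
  (r = best /\ forall j, (L <= j <= Rt)%N -> f j < theta) \/
  exists l, [/\ r = Some l, (L <= l <= Rt)%N, theta <= f l &
                forall j, (l < j <= Rt)%N -> f j < theta].

(** One probe leaves at most half of the interval, rounded down, so [N] probes suffice for fewer
    than [2 ^ N] positions. [0 < L] keeps [m.-1] a true predecessor. *)
Lemma triple_binary_search N fuel L Rt best :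
  (0 < L)%N -> (Rt < sz)%N -> (Rt.+1 - L <= fuel)%N ->
  (Rt.+1 - L < 2 ^ N)%N ->
  triple (binary_search q theta fuel L Rt best)
    (fun r ks => [/\ search_result L Rt best r, (size ks <= N)%N &
                     forall k, k \in ks -> exists i, k = kf i]).
Proof.
elim: fuel N L Rt best => [|fuel IH] N L Rt best L0 ltR lef ltN /=.
  apply: triple_ret; split=> //; left; split=> // j; lia.
case: ifPn => leLR; last first.
  apply: triple_ret; split=> //; left; split=> // j; lia.
case: N ltN => [|N]; first by rewrite expn0; lia.
rewrite expnS => ltN.
have [] : [/\ (L <= (L + Rt) %/ 2)%N, ((L + Rt) %/ 2 <= Rt)%N,
  (Rt.+1 - ((L + Rt) %/ 2).+1 < 2 ^ N)%N &
  (((L + Rt) %/ 2).-1.+1 - L < 2 ^ N)%N] by split; lia.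
set m := (_ %/ 2)%N => leLm lemR lt1 lt2.
apply: triple_bind (q_triple m) _ => x ks [-> ->].
case: ifPn => [gm|]; last rewrite -ltNge => lm.
  have := IH N m.+1 Rt (Some m) isT ltR ltac:(lia) lt1.
  apply: triple_weaken => r ks' [res szk hk]; split=> //.
    right; case: res => [[-> below]|[l [-> lel gl below]]].
      by exists m; split=> //; lia.
    by exists l; split=> //; lia.
  by move=> k; rewrite inE => /predU1P[->|/hk]//; exists m.
have := IH N L m.-1 best L0 ltac:(lia) ltac:(lia) lt2.
(* By monotonicity a miss at [m] rules out all later positions. *)
have above j : (m <= j <= Rt)%N -> f j < theta.
  by move=> lej; apply: le_lt_trans lm; apply: f_mono; lia.
apply: triple_weaken => r ks' [res szk hk]; split=> //.
  case: res => [[-> below]|[l [-> lel gl below]]].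
    left; split=> // j lej; have [ltjm|lemj] := ltnP j m.
      by apply: below; lia.
    by apply: above; lia.
  right; exists l; split=> //; first by lia.
  move=> j lej; have [ltjm|lemj] := ltnP j m.
    by apply: below; lia.
  by apply: above; lia.
by move=> k; rewrite inE => /predU1P[->|/hk]//; exists m.
Qed.

End BinarySearch.

(** * The search of one side *)

Section Side.
Variables (B : side) (ms : seq (pairing M W)) (d : pairing M W).
Variables (eps : R) (N : nat).
Hypotheses (eps_gt0 : 0 < eps) (ms_uniq : uniq ms).
Hypothesis ms_size : ((size ms).-1 < 2 ^ N)%N.
Let q i := side_welfare B (nth d ms i).
Let q' i := side_welfare (~~ B) (nth d ms i).
Hypothesis q_mono : forall i j, (i <= j)%N -> (j < size ms)%N -> q j <= q i.
Hypothesis q'_mono : forall i j, (i <= j)%N -> (j < size ms)%N -> q' i <= q' j.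

Let c_gt0 : 0 < 1 + eps. Proof. by rewrite addr_gt0. Qed.

(** The comparison with the threshold, cleared of division: every position behind the new target has
    lost the factor [1 + eps], while the new target has lost at most that, unless it is the default
    step to [t.+1]. *)
Definition next_target t (r : option (pairing M W)) : Prop :=
  if r is Some mu then exists t',
    [/\ mu = nth d ms t', (t < t' < size ms)%N,
        forall j, (t' < j < size ms)%N -> (1 + eps) * q j <= q t &
        q t <= (1 + eps) * q t' \/ t' = t.+1]
  else t.+1 = size ms.

(** One value is learned for the current target and at most [N] in the binary search. *)
Lemma triple_poset_search t : (t < size ms)%N ->
  triple (poset_search eps ms (nth d ms t) B)
    (fun r ks => [/\ next_target t r, (size ks <= N.+1)%N &
                     all (fun k => k.1 == B) ks]).
Proof.
move=> ltt; rewrite /poset_search index_uniq //.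
set tg := nth d ms t.
(* [poset_search] uses the target as default of [nth]; within range this agrees with [d]. *)
have nthE i : (i < size ms)%N -> nth tg ms i = nth d ms i.
  exact: set_nth_default.
apply: triple_bind (triple_learn _ _) _ => x ks [-> ->]; rewrite nthE //.
have mono i j : (i <= j)%N -> (j < size ms)%N ->
    side_welfare B (nth tg ms j) <= side_welfare B (nth tg ms i).
  move=> leij ltj; rewrite !nthE ?(leq_ltn_trans leij) //; exact: q_mono.
have := @triple_binary_search (fun i => learn B (nth tg ms i)) _ _ _
   (side_welfare B tg / (1 + eps)) (fun i => triple_learn B _) mono N (size ms)
   t.+1 (size ms).-1 None isT.
move=> /(_ ltac:(lia) ltac:(lia) ltac:(lia)) ts.
apply: triple_bind ts _ => r ks' [res szk hk]; apply: triple_ret.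
rewrite cats0; split; last 2 first.
- by rewrite /= ltnS.
- by rewrite /= eqxx; apply/allP => k /hk[i ->].
case: res => [[-> below]|[l [-> lel gl below]]].
  change (next_target t
    (if (t.+1 < size ms)%N then Some (nth tg ms t.+1) else None)).
  case: ifPn => [ltt'|nlt]; last by apply/eqP; rewrite eqn_leq ltt leqNgt.
  exists t.+1; split; rewrite ?nthE ?ltnSn //; last by right.
  move=> j lej; rewrite mulrC -ler_pdivlMr // ltW //.
  by rewrite /q -nthE; [apply: below|]; lia.
exists l; split; rewrite ?nthE //; first by lia.
- by lia.
- move=> j lej; rewrite mulrC -ler_pdivlMr // ltW //.
  by rewrite /q -nthE; [apply: below|]; lia.
by left; rewrite mulrC -ler_pdivrMr // /q -(nthE l) //; lia.
Qed.

Definition covered (s : seq (pairing M W)) mu : Prop :=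
  exists2 mu', mu' \in s & SW v mu <= (1 + eps) * SW v mu'.

(* Two rounds divide the welfare of [B] at the target by at least [1 + eps],
   and the matchings behind the target are one round ahead of it. *)
Definition side_inv i (st : side_state M W) : Prop :=
  [/\ (size st.2 <= i.+1)%N, {subset st.2 <= ms}, nth d ms 0 \in st.2 &
      if st.1 is Some tg then exists t,
        [/\ (t < size ms)%N, tg = nth d ms t,
            (1 + eps) ^+ i./2 * q t <= q 0%N,
            forall j, (t < j < size ms)%N ->
              (1 + eps) ^+ uphalf i * q j <= q 0%N &
            forall j, (j <= t)%N -> covered st.2 (nth d ms j)]
      else forall j, (j < size ms)%N -> covered st.2 (nth d ms j)].

Lemma SW_le_expand mu : SW v mu <= (1 + eps) * SW v mu.
Proof. by rewrite ler_peMl ?SW_ge0 // lerDl ltW. Qed.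

Lemma side_inv_start : (0 < size ms)%N ->
  side_inv 0 (Some (nth d ms 0), [:: nth d ms 0]).
Proof.
move=> sz; split=> //=.
- by move=> mu; rewrite inE => /eqP ->; apply: mem_nth.
- by rewrite inE.
- exists 0%N; split; rewrite ?expr0 ?mul1r // => j.
    by move=> /andP[_ ltj]; rewrite mul1r; apply: q_mono.
  rewrite leqn0 => /eqP ->; exists (nth d ms 0); first by rewrite inE.
  exact: SW_le_expand.
Qed.

(** The two exponents take turns: the new target lay behind the old one and inherits [uphalf i],
    while the positions behind the new target get one more than the [i./2] of the old target. *)
Lemma triple_side_step i st : side_inv i st ->
  triple (side_step eps ms B st)
    (fun st' ks => [/\ side_inv i.+1 st', (size ks <= N.+1)%N &
                       all (fun k => k.1 == B) ks]).
Proof.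
case: st => [[tg|] s] [/= sz sub hd]; last first.
  by move=> cov; apply: triple_ret; split=> //; split=> //=; apply: leqW.
case=> t [ltt -> qt qj cov]; rewrite /side_step /=.
apply: triple_bind (triple_poset_search ltt) _ => r ks [nt szk allk].
apply: triple_ret; rewrite cats0; split=> //.
case: r nt => [mu|] /=; last first.
  move=> et; split=> //=; first exact: leqW.
  by move=> j ltj; apply: cov; lia.
move=> [t' [-> /andP[ltt' ltt's] below alt]]; split=> /=.
- by rewrite size_rcons.
- by move=> nu; rewrite mem_rcons inE => /predU1P[->|/sub//]; apply: mem_nth.
- by rewrite mem_rcons inE hd orbT.
exists t'; split=> //.
- by apply: qj; rewrite ltt'.
- move=> j lej; apply: le_trans qt; rewrite exprSr -mulrA.
  by rewrite ler_pM2l ?exprn_gt0 //; apply: below.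
move=> j lej; have [lejt|lttj] := leqP j t.
  have [nu innu le] := cov j lejt; exists nu => //.
  by rewrite mem_rcons inE innu orbT.
exists (nth d ms t'); first by rewrite mem_rcons mem_head.
(* Either no position is skipped, or [B] loses at most the factor [1 + eps] and the other side loses
   nothing. *)
case: alt => [alt|et]; last first.
  have -> : j = t' by lia.
  exact: SW_le_expand.
rewrite !(SW_side B) mulrDr; apply: lerD.
  apply: le_trans alt; apply: q_mono (ltnW lttj) _.
  exact: leq_ltn_trans lej ltt's.
apply: le_trans (q'_mono lej ltt's) _.
by rewrite ler_peMl ?side_welfare_ge0 // lerDl ltW.
Qed.

(** A position behind the last target has lost [(1 + eps) ^+ uphalf i]. Tolerating one factor
    [1 + eps] on the right is what saves two rounds. *)
Lemma side_inv_end i st mu : side_inv i st -> mu \in ms ->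
  2 <= (1 + eps) ^+ (uphalf i).+1 ->
  covered st.2 mu \/
  2 * side_welfare B mu <= (1 + eps) * side_welfare B (nth d ms 0).
Proof.
case: st => [[tg|] s] [_ _ _] /= h /(nthP d)[j ltj <-] two; last first.
  by left; apply: h.
case: h => t [ltt _ _ qj cov].
have [lejt|lttj] := leqP j t; first by left; apply: cov.
right; apply: (@le_trans _ _ ((1 + eps) ^+ (uphalf i).+1 * q j)).
  by rewrite ler_wpM2r ?side_welfare_ge0.
by rewrite exprS -mulrA ler_pM2l // qj // lttj.
Qed.

End Side.

(** A step asks agents of its own side only, so each round charges each side with a single
    search. *)
Lemma triple_rounds eps N msM dM dW r i stM stW :
  let invM := side_inv Man msM dM eps in
  let invW := side_inv Woman (rev msM) dW eps in
  (forall i st, invM i st -> triple (side_step eps msM Man st)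
    (fun st' ks => [/\ invM i.+1 st', (size ks <= N)%N &
                       all (fun k => k.1 == Man) ks])) ->
  (forall i st, invW i st -> triple (side_step eps (rev msM) Woman st)
    (fun st' ks => [/\ invW i.+1 st', (size ks <= N)%N &
                       all (fun k => k.1 == Woman) ks])) ->
  invM i stM -> invW i stW ->
  triple (rounds eps msM r stM stW)
    (fun st ks => [/\ invM (i + r)%N st.1, invW (i + r)%N st.2 &
                      forall B, (count_side B ks <= r * N)%N]).
Proof.
move=> invM invW stepM stepW.
elim: r i stM stW => [|r IH] i stM stW iM iW /=.
  by apply: triple_ret; rewrite addn0; split.
apply: triple_bind (stepM _ _ iM) _ => stM' ks1 [iM' sz1 all1].
apply: triple_bind (stepW _ _ iW) _ => stW' ks2 [iW' sz2 all2].
have := IH _ _ _ iM' iW'; apply: triple_weaken => st ks3 [iM3 iW3 h3].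
rewrite addnS -addSn; split=> // B.
have := h3 B; rewrite /count_side !count_cat mulSn => h.
have one_side B' ks : all (fun k => k.1 == B') ks ->
    count (fun k : side * pairing M W => k.1 == B) ks = ((B' == B) * size ks)%N.
  elim: ks => [|k ks IHk] /=; first by rewrite muln0.
  by case/andP => /eqP -> /IHk ->; rewrite mulnS.
rewrite (one_side _ _ all1) (one_side _ _ all2) addnA leq_add //.
by case: B {h one_side}; rewrite /= ?mul1n ?mul0n ?addn0 ?add0n.
Qed.

Lemma triple_learn_all B s :
  triple (learn_all B s) (fun _ ks => forall k, k \in ks -> k.2 \in s).
Proof.
elim: s => [|mu s IH] /=; first by apply: triple_ret.
apply: triple_bind (triple_learn _ _) _ => _ ks [_ ->].
move: IH; apply: triple_weaken => _ ks' h k; rewrite !inE.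
by case/predU1P => [->|/h ->]; rewrite ?eqxx ?orbT.
Qed.

Lemma triple_select_best best x s : x = SW v best ->
  triple (select_best best x s)
    (fun mu ks => [/\ mu \in best :: s,
                      forall nu, nu \in best :: s -> SW v nu <= SW v mu &
                      forall k, k \in ks -> k.2 \in s]).
Proof.
elim: s best x => [|mu s IH] best x ex /=.
  apply: triple_ret; split=> //; first by rewrite mem_head.
  by move=> nu; rewrite inE => /eqP ->.
apply: triple_bind (triple_learn _ _) _ => yM ks1 [eM ->].
apply: triple_bind (triple_learn _ _) _ => yW ks2 [eW ->].
have eS : yM + yW = SW v mu by rewrite eM eW.
rewrite eS ex; case: ltP => cmp.
  have := IH mu _ erefl; apply: triple_weaken => r ks [inr best_r hk]; split.
  - by rewrite inE inr orbT.
  - move=> nu; rewrite inE => /predU1P[->|/best_r//].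
    by apply: le_trans (ltW cmp) _; apply: best_r; rewrite mem_head.
  - move=> k; rewrite !inE => /or3P[/eqP->|/eqP->|/hk ->] //=;
      by rewrite ?eqxx ?orbT.
have := IH best _ erefl; apply: triple_weaken => r ks [inr best_r hk]; split.
- by move: inr; rewrite !inE => /predU1P[->|->]; rewrite ?eqxx ?orbT.
- move=> nu; rewrite !inE => /or3P[/eqP->|/eqP->|ins].
  + by apply: best_r; rewrite mem_head.
  + by apply: le_trans cmp _; apply: best_r; rewrite mem_head.
  + by apply: best_r; rewrite inE ins orbT.
- move=> k; rewrite !inE => /or3P[/eqP->|/eqP->|/hk ->] //=;
    by rewrite ?eqxx ?orbT.
Qed.

End Queries.
(** * Bounds and conclusion *)

Section NumericBounds.
Variables (R : realType) (eps : R).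
Hypotheses (eps_gt0 : 0 < eps) (eps_le1 : eps <= 1).

Let ln2_gt0 : 0 < ln (2 : R).
Proof. by rewrite ln_gt0 // ltr1n. Qed.

(** Concavity: [1 + eps] is the combination of 2 and 1 with weights [eps] and [1 - eps]. *)
Lemma log2_1D_ge : eps <= log2 (1 + eps).
Proof.
have := @concave_ln R (Itv01 (ltW eps_gt0) eps_le1) 2 1 ltac:(lra) ltac:(lra).
rewrite !convRE /= ln1 mulr0 addr0 => h.
rewrite /log2 ler_pdivlMr //; apply: le_trans h _.
by rewrite ler_ln ?posrE; rewrite /unstable.onem; move: eps_gt0; lra.
Qed.

Lemma log2_1D_le1 : log2 (1 + eps) <= 1.
Proof.
rewrite /log2 ler_pdivrMr // mul1r.
by rewrite ler_ln ?posrE; move: eps_gt0 eps_le1; lra.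
Qed.

Let log_gt0 : 0 < log2 (1 + eps).
Proof. exact: lt_le_trans eps_gt0 log2_1D_ge. Qed.

(** As [log2 (1 + eps) <= 1], the ceiling is nonnegative and equals its absolute value. *)
Lemma num_rounds_itv :
  (num_rounds eps)%:R - 1 < 2 / log2 (1 + eps) - 2 <= (num_rounds eps)%:R.
Proof.
have x_ge0 : 0 <= 2 / log2 (1 + eps) - 2.
  by rewrite subr_ge0 ler_pdivlMr // ler_piMr // log2_1D_le1.
have c_ge0 : 0 <= Num.ceil (2 / log2 (1 + eps) - 2).
  by rewrite ceil_ge0; move: x_ge0; lra.
rewrite /num_rounds natr_absz ger0_norm // -[1 in X in X && _]/(1%:~R) -intrB.
exact: ceil_itv.
Qed.

Lemma num_rounds_lt : (num_rounds eps)%:R < 2 / eps - 1.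
Proof.
have /andP[h _] := num_rounds_itv.
have : 2 / log2 (1 + eps) <= 2 / eps.
  by rewrite ler_pM2l // lef_pV2 ?posrE // log2_1D_ge.
by move: h; lra.
Qed.

(** In logarithms, with [K] rounds: [uphalf K + 1] must reach [1 / log2 (1 + eps)], which follows
    from [K <= 2 * uphalf K]. *)
Lemma num_rounds_expand : 2 <= (1 + eps) ^+ (uphalf (num_rounds eps)).+1.
Proof.
have c_gt0 : 0 < 1 + eps by rewrite addr_gt0.
have /andP[_ h] := num_rounds_itv.
have half : (num_rounds eps <= 2 * uphalf (num_rounds eps))%N.
  by rewrite uphalf_half; lia.
have half' : (num_rounds eps)%:R <= 2 * (uphalf (num_rounds eps))%:R :> R.
  by rewrite -natrM ler_nat.
rewrite -ler_ln ?posrE ?exprn_gt0 // lnXn // -[ln (1 + eps) *+ _]mulr_natl.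
rewrite -ler_pdivrMr ?ln_gt0 ?ltrDl //.
have -> : ln 2 / ln (1 + eps) = (log2 (1 + eps))^-1 by rewrite /log2 invf_div.
by rewrite -natr1; move: h half'; lra.
Qed.

End NumericBounds.

Lemma sorted_mono (R : numDomainType) (T : eqType) (r : rel T) (f : T -> R)
    d s :
  transitive r -> (forall x y, r x y -> f y <= f x) -> sorted r s ->
  forall i j, (i <= j)%N -> (j < size s)%N -> f (nth d s j) <= f (nth d s i).
Proof.
move=> tr fr so i j; rewrite leq_eqVlt => /predU1P[->//|ltij] ltj.
by apply: fr; apply: sorted_ltn_nth => //; rewrite inE // (ltn_trans ltij).
Qed.

(** For [z > 0], [N] is the bit length of [z], so [2 ^ (N + 3)] is at most [16 * z], hence at most
    [8 * n * n.-1]. The offset 3 makes room for the other three queries charged to each round. *)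
Lemma binary_search_depth n z : (2 <= n)%N -> (2 * z <= n * n.-1)%N ->
  exists2 N, (z < 2 ^ N)%N & (2 ^ (N + 3) <= n ^ 4)%N.
Proof.
move=> n2 lez; case: (posnP z) => [->|z0].
  exists 0%N; rewrite ?expn0 //.
  by apply: leq_trans (_ : 2 ^ 4 <= _)%N; rewrite ?leq_exp2l ?leq_exp2r.
exists (trunc_log 2 z).+1; first exact: trunc_log_ltn.
have lo : (2 ^ trunc_log 2 z <= z)%N by apply: trunc_logP.
have -> : ((trunc_log 2 z).+1 + 3 = trunc_log 2 z + 4)%N by lia.
rewrite expnD; set t := (2 ^ trunc_log 2 z)%N in lo *.
have h : (2 * t <= n * n.-1)%N by lia.
have : (8 * n.-1 <= n ^ 3)%N.
  by case: n n2 {lez h} => [|[|n]] // _; rewrite !expnS expn0 /=; nia.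
rewrite (expnS n 3) => h8.
apply: leq_trans (leq_mul (leqnn n) h8).
lia.
Qed.

(** * Correctness and cost of the whole run *)

Section HassePathRun.
Variables (R : realType) (M W : finType) (P : preferences M W).
Variables (mu0 : pairing M W) (rhos : seq (rotation M W)) (eps : R).
Variable v : valuations R M W.
Hypotheses (mu0_opt : man_optimal P mu0) (rhos_path : hasse_path P rhos).
Hypotheses (eps_gt0 : 0 < eps) (eps_le1 : eps <= 1).
Hypothesis v_consistent : consistent P v.

Let ms : seq (pairing M W) := chain_matchings mu0 rhos.
Let K := num_rounds eps.

(** For each side, [s] gathers the matchings evaluated in its searches, at most [K * N.+1], and both
    lists of targets, each of length at most [K.+1]. *)
Lemma triple_hasse_path_comp N : (size rhos < 2 ^ N)%N ->
  triple v (hasse_path_comp rhos mu0 eps)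
    (fun mu ks =>
      [/\ mu \in ms, forall nu, nu \in ms -> SW v nu <= (1 + eps) * SW v mu &
          forall B, exists2 s, (size s <= K * N.+1 + 2 * K.+1)%N &
                               forall k, k \in ks -> k.1 = B -> k.2 \in s]).
Proof.
move=> ltN.
have [muz elz] := elimination_path mu0_opt rhos_path.
have so : sorted (chain_rel P v) ms := chain_sorted v_consistent elz.
have tr := @chain_rel_trans R M W P v.
have un : uniq ms by apply: (sorted_uniq tr) so; apply: chain_rel_irr.
(* The women search from the other end of the chain, from which their welfare falls. *)
pose flip_rel : rel (pairing M W) := fun x y => chain_rel P v y x.
have so' : sorted flip_rel (rev ms) by rewrite rev_sorted.
have tr' : transitive flip_rel by move=> y x z h1 h2; apply: tr h2 h1.
have unr : uniq (rev ms) by rewrite rev_uniq.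
have szms : ((size ms).-1 < 2 ^ N)%N by rewrite /ms /= size_scanl.
have szrev : ((size (rev ms)).-1 < 2 ^ N)%N by rewrite size_rev.
have ms0 : (0 < size ms)%N by [].
have rev0 : (0 < size (rev ms))%N by rewrite size_rev.
have relM mu mu' : chain_rel P v mu mu' -> SW_M v mu' <= SW_M v mu.
  by case/and3P.
have relW mu mu' : chain_rel P v mu mu' -> - SW_W v mu' <= - SW_W v mu.
  by case/and3P => _ le_SW _; rewrite lerN2.
have monoM := sorted_mono mu0 tr relM so.
have monoM' i j : (i <= j)%N -> (j < size ms)%N ->
    SW_W v (nth mu0 ms i) <= SW_W v (nth mu0 ms j).
  move=> leij ltj; rewrite -lerN2.
  exact: (sorted_mono (f := fun x => - SW_W v x) _ tr relW so) leij ltj.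
have monoW := sorted_mono (f := SW_W v) mu0 tr'
  (fun x y h => ltac:(by case/and3P: h)) so'.
have monoW' i j : (i <= j)%N -> (j < size (rev ms))%N ->
    SW_M v (nth mu0 (rev ms) i) <= SW_M v (nth mu0 (rev ms) j).
  move=> leij ltj; rewrite -lerN2.
  apply: (sorted_mono (f := fun x => - SW_M v x) _ tr') leij ltj => //.
  by move=> x y /relM; rewrite lerN2.
have stepM := @triple_side_step R M W v Man ms mu0 eps N eps_gt0 un szms
  monoM monoM'.
have stepW := @triple_side_step R M W v Woman (rev ms) mu0 eps N eps_gt0 unr
  szrev monoW monoW'.
have startM := side_inv_start (B := Man) eps_gt0 monoM ms0.
have startW := side_inv_start (B := Woman) eps_gt0 monoW rev0.
have lastE : nth mu0 (rev ms) 0 = last mu0 ms.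
  by rewrite nth_rev // subn1 nth_last.
rewrite lastE in startW.
rewrite /hasse_path_comp.
apply: triple_bind (triple_rounds K stepM stepW startM startW) _.
move=> st ks1 [iM iW cnt].
apply: triple_bind (triple_learn_all Woman st.1.2) _ => _ ks2 h2.
apply: triple_bind (triple_learn_all Man st.2.2) _ => _ ks3 h3.
apply: triple_bind (triple_learn Man mu0) _ => xM ks4 [exM ->].
apply: triple_bind (triple_learn Woman mu0) _ => xW ks5 [exW ->].
have exS : xM + xW = SW v mu0 by rewrite exM exW.
have := triple_select_best (st.1.2 ++ st.2.2) exS.
apply: triple_weaken => mu ks6 [inmu best h6].
have [szM subM hdM _] := iM; have [szW subW hdW _] := iW.
have in0 : mu0 \in st.1.2 by [].
have {}inmu : mu \in st.1.2 ++ st.2.2.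
  by move: inmu; rewrite inE => /predU1P[->|//]; rewrite mem_cat in0.
have {}best nu : nu \in st.1.2 ++ st.2.2 -> SW v nu <= SW v mu.
  by move=> innu; apply: best; rewrite inE innu orbT.
have bestM nu : nu \in st.1.2 -> SW v nu <= SW v mu.
  by move=> h; apply: best; rewrite mem_cat h.
have bestW nu : nu \in st.2.2 -> SW v nu <= SW v mu.
  by move=> h; apply: best; rewrite mem_cat h orbT.
have c_gt0 : 0 < 1 + eps by rewrite addr_gt0.
have two := num_rounds_expand eps_gt0 eps_le1.
split.
- by move: inmu; rewrite mem_cat => /orP[/subM|/subW] //; rewrite mem_rev.
- move=> nu innu.
  case: (side_inv_end eps_gt0 iM innu two) => [[mu' /bestM le1 le2]|leM].
    by apply: le_trans le2 _; rewrite ler_pM2l.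
  have innu' : nu \in rev ms by rewrite mem_rev.
  case: (side_inv_end eps_gt0 iW innu' two) => [[mu' /bestW le1 le2]|leW].
    by apply: le_trans le2 _; rewrite ler_pM2l.
  have b1 := bestM _ hdM; have b2 := bestW _ hdW.
  have wW := side_welfare_ge0 v Woman (nth mu0 ms 0).
  have wM := side_welfare_ge0 v Man (nth mu0 (rev ms) 0).
  (* Neither side covers [nu]. The two bounds add up to [1 + eps] times the men's welfare at one
     endpoint plus the women's at the other; both endpoints are listed, so each summand is at most
     [SW v mu]. *)
  have : 2 * SW v nu <= 2 * ((1 + eps) * SW v mu).
    rewrite (SW_side v Man) mulrDr; apply: le_trans (lerD leM leW) _.
    rewrite -mulrDr mulrCA ler_pM2l //.
    rewrite mulr_natl mulr2n; apply: lerD.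
      apply: le_trans b1; rewrite (SW_side v Man) lerDl; exact: wW.
    apply: le_trans b2; rewrite (SW_side v Woman) lerDl; exact: wM.
  by rewrite ler_pM2l.
- move=> B; exists (map snd [seq k <- ks1 | k.1 == B] ++ (st.1.2 ++ st.2.2)).
    rewrite !size_cat size_map size_filter; apply: leq_add; first exact: cnt.
    by rewrite mul2n -addnn; apply: leq_add.
  move=> k; rewrite !mem_cat => /or4P[h|h|h|h] eB.
  + by rewrite map_f // mem_filter eB eqxx.
  + by rewrite (h2 _ h) !orbT.
  + by rewrite (h3 _ h) !orbT.
  move: h; rewrite !inE => /or3P[/eqP->|/eqP->|/h6]; rewrite /= ?in0 ?orbT //.
  by rewrite mem_cat => ->; rewrite orbT.
Qed.

End HassePathRun.

Unset Implicit Arguments.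

Theorem theoremD1 (R : realType) (n : nat) (M W : finType)
    (P : preferences M W) (mu0 : pairing M W) (rhos : seq (rotation M W))
    (eps : R) (cardM : #|M| = n) (cardW : #|W| = n)
    (mu0_opt : man_optimal P mu0) (rhos_path : hasse_path P rhos)
    (eps_gt0 : 0 < eps) (eps_le1 : eps <= 1) :
  forall v : valuations R M W, consistent P v ->
    let: (muA, qs) := run v (HassePath rhos mu0 eps) in
    [/\ stable P muA,
        forall mu, stable P mu -> SW v mu <= (1 + eps) * SW v muA &
        (2 <= n)%N ->
          forall a : M + W,
            (num_queries a qs)%:R <= 8 * log2 (n%:R : R) / eps].
Proof.
move=> v v_cons.
have chain := chain_mem mu0_opt rhos_path.
(* For [n < 2] no query bound is claimed, and any [N] with [size rhos < 2 ^ N] will do. *)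
have [N ltN powN] : exists2 N, (size rhos < 2 ^ N)%N &
    (2 <= n)%N -> (2 ^ (N + 3) <= n ^ 4)%N.
  have := size_path mu0_opt rhos_path; rewrite cardM cardW => lez.
  have [n2|_] := leqP 2 n.
    by have [N h1 h2] := binary_search_depth n2 lez; exists N.
  by exists (size rhos) => //; apply: ltn_expl.
have mem0 : correct_memory v [::] by [].
have [mu [mem' [ks [qs [er [un _] [inmu best cover] sub num]]]]] :=
  triple_hasse_path_comp mu0_opt rhos_path eps_gt0 eps_le1 v_cons ltN mem0.
rewrite /HassePath run_bind er /= cats0; split.
- exact/chain.
- by move=> nu /chain; apply: best.
move=> n2 a.
set K := num_rounds eps in cover.
(* The right side is [K * N.+1 + 2 * K.+1] regrouped. *)
have bound : (num_queries a qs <= K * (N + 3) + 2)%N.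
  have [s szs hs] := cover (side_of a).
  have := num a; rewrite addn0 => ->.
  apply: leq_trans (_ : size s <= _)%N; last by lia.
  (* The keys of one side are distinct, hence so are their matchings, which all lie in [s]. *)
  rewrite /count_side -size_filter -(size_map snd).
  apply: uniq_leq_size.
    rewrite map_inj_in_uniq ?filter_uniq //.
    move=> [b1 m1] [b2 m2]; rewrite !mem_filter /= => /andP[/eqP -> _].
    by move=> /andP[/eqP -> _] ->.
  move=> m /mapP[k]; rewrite mem_filter => /andP[/eqP eB /sub ink] ->.
  exact: hs.
have ln2_gt0 : 0 < ln (2 : R) by rewrite ln_gt0 // ltr1n.
have n_gt0 : 0 < n%:R :> R by rewrite ltr0n; lia.
have logN : (N + 3)%:R <= 4 * log2 (n%:R : R).
  rewrite /log2 mulrA ler_pdivlMr // mulr_natl -lnXn //.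
  rewrite mulr_natl -lnXn // ler_ln ?posrE ?exprn_gt0 //.
  by rewrite -!natrX ler_nat; apply: powN.
have log1 : 1 <= log2 (n%:R : R).
  by rewrite /log2 ler_pdivlMr // mul1r ler_ln ?posrE // ler_nat.
have Klt := num_rounds_lt eps_gt0 eps_le1.
apply: (@le_trans _ _ ((K * (N + 3) + 2)%:R)); first by rewrite ler_nat.
rewrite natrD natrM.
apply: (@le_trans _ _ (K%:R * (4 * log2 (n%:R : R)) + 2)).
  by rewrite lerD2r ler_wpM2l.
have -> : 8 * log2 n%:R / eps = 2 / eps * (4 * log2 (n%:R : R)).
  by field; rewrite lt0r_neq0.
(* The 1 subtracted in [Klt] frees [4 * log2 n], at least 4, which pays for the 2. *)
by rewrite -/K in Klt; nra.
Qed.
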